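(* Let $m\ge 1$ be an integer. Every semialgebraic subset $Y\subset\mathbb{R}^m$ has property P; that is, there are an integer $k\ge 0$ and a real algebraic set $X\subset\mathbb{R}^m\times\mathbb{R}^k$ whose image under the projection $\mathbb{R}^m\times\mathbb{R}^k\to\mathbb{R}^m$ is exactly $Y$.
   Context: A real algebraic set in $\mathbb{R}^N$ is the set of common real zeros of finitely many real polynomials (equivalently, the zero set of a single real polynomial). A semialgebraic subset of $\mathbb{R}^m$ is a finite union of sets each defined by finitely many real polynomial equations and strict inequalities. A subset $Y\subset\mathbb{R}^m$ has property P if there is a real algebraic set $X\subset\mathbb{R}^m\times\mathbb{R}^k$, for some integer $k\ge 0$, whose projection to $\mathbb{R}^m$ is exactly $Y$. *)

(* Defs.v *)
From mathcomp Require Import all_boot all_order all_algebra.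
From mathcomp Require Import boolp classical_sets reals.
From mathcomp Require Import mpoly.

Set Implicit Arguments.
Unset Strict Implicit.
Unset Printing Implicit Defensive.

Import Order.TTheory GRing.Theory Num.Theory.

Local Open Scope ring_scope.
Local Open Scope classical_set_scope.

Definition peval (R : realType) (n : nat) (p : {mpoly R[n]}) (x : 'rV[R]_n) : R :=
  p.@[fun i => x 0 i].

Definition zero_set (R : realType) (n : nat) (s : seq {mpoly R[n]}) :
    set 'rV[R]_n :=
  [set x | forall p, p \in s -> peval p x = 0].

Definition positive_set (R : realType) (n : nat) (s : seq {mpoly R[n]}) :
    set 'rV[R]_n :=
  [set x | forall p, p \in s -> 0 < peval p x].

Definition algebraic_set (R : realType) (n : nat) (X : set 'rV[R]_n) : Prop :=
  exists s : seq {mpoly R[n]}, X = zero_set s.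

(* A pair [c] stands for the system [p = 0] for [p] in [c.1] and [0 < q] for
   [q] in [c.2]; a condition [q < 0] is entered as [0 < - q]. *)
Definition semialgebraic_set (R : realType) (n : nat) (Y : set 'rV[R]_n) : Prop :=
  exists F : seq (seq {mpoly R[n]} * seq {mpoly R[n]}),
    Y = \bigcup_(c in [set` F]) (zero_set c.1 `&` positive_set c.2).

(* R^m x R^k is 'rV[R]_(m + k), via [row_mx]; [lsubmx] is the projection to the
   first [m] coordinates. *)
Definition property_P (R : realType) (m : nat) (Y : set 'rV[R]_m) : Prop :=
  exists (k : nat) (X : set 'rV[R]_(m + k)),
    algebraic_set X /\ [set lsubmx z | z in X] = Y.

(* Main.v *)
Require Import Defs.
From mathcomp Require Import all_boot all_order all_algebra.
From mathcomp Require Import boolp classical_sets reals.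
From mathcomp Require Import mpoly.

(** Introducing auxiliary unknowns turns the solution set of an inequality into
    the projection of the solution set of an equation: over the reals, [0 < a]
    holds exactly when [a * t ^+ 2 = 1] is solvable in [t]
    ([property_P_positive1]). It then remains to see that projections of
    algebraic sets are stable under finite intersections ([property_PI]) and
    finite unions ([property_PU]). Both reduce to the same stability of
    algebraic sets once each of the two sets is given its own block of
    auxiliary coordinates, so that the witnesses for one do not constrain the
    witnesses for the other. *)

Set Implicit Arguments.
Unset Strict Implicit.
Unset Printing Implicit Defensive.

Import Order.TTheory GRing.Theory Num.Theory.

Local Open Scope ring_scope.
Local Open Scope classical_set_scope.

Lemma algebraic_setT (R : realType) (n : nat) :
  algebraic_set (setT : set 'rV[R]_n).
Proof. by exists [::]; apply/seteqP; split=> x. Qed.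

Lemma algebraic_set0 (R : realType) (n : nat) :
  algebraic_set (set0 : set 'rV[R]_n).
Proof.
exists [:: 1]; apply/seteqP; split=> x // /(_ 1); rewrite mem_head => /(_ isT).
by rewrite /peval meval1 => /eqP; rewrite oner_eq0.
Qed.

Lemma algebraic_set1 (R : realType) (n : nat) (p : {mpoly R[n]}) :
  algebraic_set [set x | peval p x = 0].
Proof.
exists [:: p]; apply/seteqP; split=> x /= hx; last by apply: hx; rewrite mem_head.
by move=> q; rewrite inE => /eqP->.
Qed.

Lemma algebraic_setI (R : realType) (n : nat) (X1 X2 : set 'rV[R]_n) :
  algebraic_set X1 -> algebraic_set X2 -> algebraic_set (X1 `&` X2).
Proof.
move=> [s1 ->] [s2 ->]; exists (s1 ++ s2); apply/seteqP; split=> x /=.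
  by move=> [h1 h2] p; rewrite mem_cat => /orP[/h1|/h2].
by move=> h; split=> p hp; apply: h; rewrite mem_cat hp ?orbT.
Qed.

(** The union is cut out by all products of an equation of the first set with
    an equation of the second one: at a point where some equation of the first
    set fails, the products with it force every equation of the second. *)
Lemma algebraic_setU (R : realType) (n : nat) (X1 X2 : set 'rV[R]_n) :
  algebraic_set X1 -> algebraic_set X2 -> algebraic_set (X1 `|` X2).
Proof.
move=> [s1 ->] [s2 ->]; exists [seq p * q | p <- s1, q <- s2].
apply/seteqP; split=> x /=.
  move=> h _ /allpairsP[[p q] /= [ps1 qs2 ->]]; rewrite /peval mevalM.
  case: h => [/(_ p ps1)|/(_ q qs2)]; rewrite /peval => ->.
    by rewrite mul0r.
  by rewrite mulr0.
move=> h; have [h1|] := pselect (zero_set s1 x); first by left.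
move=> /existsNP[p /not_implyP[ps1 /eqP px]]; right=> q qs2.
have := h (p * q) (allpairs_f _ ps1 qs2).
by rewrite /peval mevalM => /eqP; rewrite mulf_eq0 (negPf px) => /eqP.
Qed.

Definition mrename (R : realType) (n n' : nat) (f : 'I_n -> 'I_n')
    (p : {mpoly R[n]}) : {mpoly R[n']} :=
  p \mPo [tuple 'X_(f i) | i < n].

Lemma peval_mrename (R : realType) (n n' : nat) (f : 'I_n -> 'I_n')
    (p : {mpoly R[n]}) (x : 'rV[R]_n') :
  peval (mrename f p) x = peval p (colsub f x).
Proof.
rewrite /peval /mrename comp_mpoly_meval; apply: meval_eq => i.
by rewrite tnth_mktuple mevalXU mxE.
Qed.

Lemma algebraic_set_colsub (R : realType) (n n' : nat) (f : 'I_n -> 'I_n')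
    (X : set 'rV[R]_n) :
  algebraic_set X -> algebraic_set [set x | X (colsub f x)].
Proof.
move=> [s ->]; exists (map (mrename f) s); apply/seteqP; split=> x /= h.
  by move=> _ /mapP[p ps ->]; rewrite peval_mrename h.
by move=> p ps; rewrite -peval_mrename h// map_f.
Qed.

Lemma property_PE (R : realType) (m : nat) (Y : set 'rV[R]_m) :
  property_P Y <->
  exists (k : nat) (X : set 'rV[R]_(m + k)),
    algebraic_set X /\ forall x, Y x <-> exists y : 'rV_k, X (row_mx x y).
Proof.
split=> -[k [X [hX hY]]]; exists k, X; split=> //.
  move=> x; rewrite -hY; split=> [[z Xz <-]|[y Xy]].
    by exists (rsubmx z); rewrite hsubmxK.
  by exists (row_mx x y); rewrite ?row_mxKl.
apply/seteqP; split=> x /=.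
  by move=> [z Xz <-]; apply/hY; exists (rsubmx z); rewrite hsubmxK.
by move=> /hY[y Xy]; exists (row_mx x y); rewrite ?row_mxKl.
Qed.

Lemma property_P_algebraic (R : realType) (m : nat) (Y : set 'rV[R]_m) :
  algebraic_set Y -> property_P Y.
Proof.
move=> hY; apply/property_PE; exists 0%N.
exists [set z | Y (colsub (lshift 0) z)]; split; first exact: algebraic_set_colsub.
have e (x : 'rV[R]_m) (y : 'rV_0) : colsub (lshift 0) (row_mx x y) = x.
  by apply/rowP => i; rewrite mxE row_mxEl.
by move=> x; split=> [Yx|[y]] /=; [exists 0 => /=|]; rewrite e.
Qed.

(** The inequality [0 < p] is the solvability in [t] of [p * t ^+ 2 = 1]: a
    solution forces [p] to be positive because squares are nonnegative, and
    conversely [t] is the inverse of a square root of the value of [p]. *)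
Lemma property_P_positive1 (R : realType) (m : nat) (p : {mpoly R[m]}) :
  property_P [set x | 0 < peval p x].
Proof.
apply/property_PE; exists 1%N.
pose q : {mpoly R[m + 1]} := mrename (lshift 1) p * 'X_(rshift m ord0) ^+ 2 - 1.
exists [set z | peval q z = 0]; split; first exact: algebraic_set1.
have qE (x : 'rV[R]_m) (y : 'rV_1) :
    peval q (row_mx x y) = peval p x * y 0 0 ^+ 2 - 1.
  rewrite /q {1}/peval mevalB mevalM rmorphXn /= mevalXU row_mxEr meval1.
  rewrite -[meval _ (mrename _ _)]/(peval _ _) peval_mrename.
  by congr (peval p _ * _ - _); apply/rowP => i; rewrite mxE row_mxEl.
move=> x /=; split=> [px|[y]].
  exists (const_mx (Num.sqrt (peval p x))^-1).
  by rewrite qE mxE exprVn sqr_sqrtr ?ltW// divff ?subrr// gt_eqF.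
rewrite qE => /eqP; rewrite subr_eq0 => /eqP pty.
rewrite ltNge; apply/negP => px.
have := mulr_le0_ge0 px (sqr_ge0 (y 0 0)).
by rewrite pty ler10.
Qed.

(** The two projections [R^(m + (k1 + k2)) -> R^(m + k_i)] forgetting the other
    block of auxiliary coordinates, given on indices. *)
Definition first_block (m k1 k2 : nat) (i : 'I_(m + k1)) : 'I_(m + (k1 + k2)) :=
  match split i with
  | inl a => lshift (k1 + k2) a
  | inr b => rshift m (lshift k2 b)
  end.

Definition second_block (m k1 k2 : nat) (i : 'I_(m + k2)) : 'I_(m + (k1 + k2)) :=
  match split i with
  | inl a => lshift (k1 + k2) a
  | inr b => rshift m (rshift k1 b)
  end.

Lemma colsub_first_block (R : realType) (m k1 k2 : nat) (x : 'rV[R]_m)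
    (y : 'rV[R]_k1) (z : 'rV[R]_k2) :
  colsub (@first_block m k1 k2) (row_mx x (row_mx y z)) = row_mx x y.
Proof.
apply/rowP => i; rewrite mxE [RHS]mxE /first_block.
by case: (split i) => a; rewrite ?row_mxEl// row_mxEr row_mxEl.
Qed.

Lemma colsub_second_block (R : realType) (m k1 k2 : nat) (x : 'rV[R]_m)
    (y : 'rV[R]_k1) (z : 'rV[R]_k2) :
  colsub (@second_block m k1 k2) (row_mx x (row_mx y z)) = row_mx x z.
Proof.
apply/rowP => i; rewrite mxE [RHS]mxE /second_block.
by case: (split i) => a; rewrite ?row_mxEl// row_mxEr row_mxEr.
Qed.

Lemma property_PI (R : realType) (m : nat) (Y1 Y2 : set 'rV[R]_m) :
  property_P Y1 -> property_P Y2 -> property_P (Y1 `&` Y2).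
Proof.
move=> /property_PE[k1 [X1 [hX1 hY1]]] /property_PE[k2 [X2 [hX2 hY2]]].
apply/property_PE; exists (k1 + k2)%N.
exists ([set z | X1 (colsub (@first_block m k1 k2) z)] `&`
        [set z | X2 (colsub (@second_block m k1 k2) z)]).
split; first by apply: algebraic_setI; exact: algebraic_set_colsub.
move=> x; split=> [[/hY1[y1 h1] /hY2[y2 h2]]|[y]].
  by exists (row_mx y1 y2); split; rewrite /= ?colsub_first_block
    ?colsub_second_block.
rewrite -(hsubmxK y) => -[] /=; rewrite colsub_first_block colsub_second_block.
by move=> h1 h2; split; [apply/hY1|apply/hY2]; eexists; eassumption.
Qed.

(** A point of one of the two sets has its witness in the block of that set;
    the union does not constrain the other block, which is filled with [0]. *)
Lemma property_PU (R : realType) (m : nat) (Y1 Y2 : set 'rV[R]_m) :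
  property_P Y1 -> property_P Y2 -> property_P (Y1 `|` Y2).
Proof.
move=> /property_PE[k1 [X1 [hX1 hY1]]] /property_PE[k2 [X2 [hX2 hY2]]].
apply/property_PE; exists (k1 + k2)%N.
exists ([set z | X1 (colsub (@first_block m k1 k2) z)] `|`
        [set z | X2 (colsub (@second_block m k1 k2) z)]).
split; first by apply: algebraic_setU; exact: algebraic_set_colsub.
move=> x; split=> [[/hY1[y1 h1]|/hY2[y2 h2]]|[y]].
- by exists (row_mx y1 0); left; rewrite /= colsub_first_block.
- by exists (row_mx 0 y2); right; rewrite /= colsub_second_block.
rewrite -(hsubmxK y) => -[] /=.
  by rewrite colsub_first_block => h; left; apply/hY1; eexists; eassumption.
by rewrite colsub_second_block => h; right; apply/hY2; eexists; eassumption.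
Qed.

Lemma property_P_positive (R : realType) (m : nat) (s : seq {mpoly R[m]}) :
  property_P (positive_set s).
Proof.
elim: s => [|p s IHs].
  rewrite (_ : positive_set _ = setT); last by apply/seteqP; split=> x.
  exact/property_P_algebraic/algebraic_setT.
rewrite (_ : positive_set _ = [set x | 0 < peval p x] `&` positive_set s).
  by apply: property_PI => //; exact: property_P_positive1.
apply/seteqP; split=> x /= => [h|[px h] q].
  by split=> [|q qs]; apply: h; rewrite inE ?eqxx// qs orbT.
by rewrite inE => /orP[/eqP->//|/h].
Qed.

Theorem mainTheorem2 (R : realType) (m : nat) (hm : (1 <= m)%N)
    (Y : set 'rV[R]_m) (hY : semialgebraic_set Y) :
  property_P Y.
Proof.
case: hY => F ->; elim: F => [|[s t] F IHF].
  rewrite (_ : \bigcup_(c in _) _ = set0).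
    exact/property_P_algebraic/algebraic_set0.
  by apply/seteqP; split=> x // [c].
rewrite (_ : \bigcup_(c in _) _ = (zero_set s `&` positive_set t) `|`
    \bigcup_(c in [set` F]) (zero_set c.1 `&` positive_set c.2)).
  apply: property_PU => //; apply: property_PI; last exact: property_P_positive.
  by apply: property_P_algebraic; exists s.
apply/seteqP; split=> x /=.
  by move=> [c /=]; rewrite inE => /orP[/eqP-> h|cF h]; [left|right; exists c].
move=> [h|[c cF h]]; first by exists (s, t) => //=; rewrite inE eqxx.
by exists c => //=; rewrite inE [X in _ || X]cF orbT.
Qed.
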